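(* For integers $r$ and $s$ with $1\le r\le s$ and a prime number $p$, the Norman permutation $\pi(r,s,p)$ satisfies $\pi(r,s,p)^2=1$.
   Context: Write $[r]=\{1,\dots,r\}$. Let $N_\ell$ be the $\ell\times\ell$ matrix with $1$ in entries $(i,i+1)$, $1\le i<\ell$, and zeros elsewhere, and $J_\ell=I_\ell+N_\ell$ (unipotent Jordan block). For $1\le r\le s$ and a prime $p$, over any field of characteristic $p$ the Jordan canonical form of $J_r\otimes J_s$ is $\bigoplus_{i=1}^r J_{\lambda_i}$ with $\lambda_1\ge\cdots\ge\lambda_r>0$ and $\sum_i\lambda_i=rs$; the partition $\lambda(r,s,p):=(\lambda_1,\dots,\lambda_r)$ has exactly $r$ nonzero parts and depends only on $r,s,p$. The Norman permutation $\pi(r,s,p):[r]\to[r]$ is the permutation $n\mapsto n^{\pi(r,s,p)}=(r+1-n)+s-\lambda_n$. *)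

(* Defs.v *)
From HB Require Import structures.
From mathcomp Require Import all_boot all_order all_fingroup all_algebra.
From mathcomp Require Export mxtens.

Set Implicit Arguments.
Unset Strict Implicit.
Unset Printing Implicit Defensive.

Import GRing.Theory.
Local Open Scope ring_scope.

Definition shift_mx (F : fieldType) (l : nat) : 'M[F]_l :=
  \matrix_(i < l, j < l) (j == i.+1 :> nat)%:R.

Definition jordan_block (F : fieldType) (l : nat) : 'M[F]_l :=
  1%:M + shift_mx F l.

(* The Jordan canonical form of A is the direct sum of the unipotent Jordan
   blocks of sizes lam_1 >= ... >= lam_k > 0. The equation e only aligns the
   dimension of the block diagonal matrix with that of A. *)
Definition unipotent_jordan_type (F : fieldType) (n : nat) (A : 'M[F]_n)
    (k : nat) (lam : k.-tuple nat) : Prop :=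
  [/\ sorted geq lam, all (leq 1) lam &
      exists e : (\sum_(i < k) tnth lam i)%N = n,
        A ~_{in unitmx}
          castmx (e, e) (\mxdiag_(i < k) jordan_block F (tnth lam i))].

(* The element n of [r] = {1, ..., r} is represented by the ordinal of value
   n - 1, hence the successors; the equation is stated in int, so that no
   subtraction is truncated. *)
Definition is_norman_perm (r s : nat) (lam : r.-tuple nat) (pi : {perm 'I_r})
    : Prop :=
  forall n : 'I_r,
    ((pi n).+1)%:Z = (r%:Z + 1 - (n.+1)%:Z) + s%:Z - (tnth lam n)%:Z.

(* Main.v *)
(* With x and y nilpotent commuting operators such that t = J_r (x) J_s - 1 is
   x + y, the space is F[x, y]/(x^r, y^s), graded by degree, and the coefficient
   of x^(r-1) y^(s-1) gives a perfect pairing on it; let N = r + s - 2. The Gram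
   matrix S_ab = <x^a, x^b t^(N-a-b)> = C(N-a-b, s-1) is a symmetric invertible
   Hankel matrix. Its Bruhat decomposition L S U = P yields generators
   u_a = sum_c L_ac x^c t^(a-c) and dual generators v_b for which the pairing of
   u_a t^i with v_b t^j is 1 if b = sigma(a) and i + j = N - a - b, and is 0
   otherwise. Hence t has one Jordan block of size N + 1 - a - sigma(a) for each
   a < r. As S is symmetric, sigma is an involution; as S is Hankel, these sizes
   are nonincreasing in a, so the Norman permutation is sigma. *)

Require Import Defs.
From mathcomp Require Import all_boot all_order all_fingroup all_algebra.
From mathcomp Require Import zify ring.

Set Implicit Arguments.
Unset Strict Implicit.
Unset Printing Implicit Defensive.

Import GRing.Theory.
Local Open Scope ring_scope.

(** * Partial permutation matrices and the Bruhat decomposition of a symmetric matrix *)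

(** The rows in [D] are distinct unit vectors and the others vanish, so the selected rows satisfy
    [B *m B^T = 1%:M]. *)
Lemma rank_partial_perm_mx (F : fieldType) (m n : nat) (A : 'M[F]_(m, n))
    (D : {pred 'I_m}) (f : 'I_m -> 'I_n) :
    (forall i j, A i j = ((i \in D) && (j == f i))%:R) ->
    {in D &, injective f} ->
  \rank A = #|D|.
Proof.
move=> AE f_inj; pose B := rowsub (enum_val : 'I_#|D| -> 'I_m) A.
have BBt : B *m B^T = 1%:M.
  apply/matrixP=> i k; rewrite !mxE (bigD1 (f (enum_val i))) //=.
  rewrite big1 => [|j /negPf j_ne]; last first.
    by rewrite !mxE !AE j_ne andbF mul0r.
  rewrite addr0 !mxE !AE !enum_valP eqxx mul1r; congr (_ : bool)%:R.
  apply/eqP/eqP => [|-> //] /(f_inj _ _ (enum_valP i) (enum_valP k)).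
  exact: enum_val_inj.
have -> : \rank A = \rank B.
  apply/eqP; rewrite eqn_leq !mxrankS //; apply/row_subP => i.
    by rewrite row_rowsub row_sub.
  have [iD|iND] := boolP (i \in D).
    have <- : row (enum_rank_in iD i) B = row i A.
      by rewrite row_rowsub enum_rankK_in.
    exact: row_sub.
  have -> : row i A = 0 by apply/rowP=> j; rewrite !mxE AE (negPf iND).
  exact: sub0mx.
apply/eqP; rewrite -[_ == _]/(row_free B).
by apply/row_freeP; exists B^T.
Qed.

(** Forward substitution: entry [j] of [z *m U] involves only the [z 0 i] with [i <= j]. *)
Lemma upper_solve (F : fieldType) (m : nat) (U : 'M[F]_m) (z : 'rV[F]_m)
    (n : nat) :
    (forall i j : 'I_m, (j < i)%N -> U i j = 0) -> (forall i, U i i != 0) ->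
    (forall j : 'I_m, (j < n)%N -> (z *m U) 0 j = 0) ->
  forall j : 'I_m, (j < n)%N -> z 0 j = 0.
Proof.
move=> U0 Ud zU j; have [k] := ubnP (j : nat).
elim: k j => // k IH j /ltnSE le_jk lt_jn.
have := zU j lt_jn; rewrite mxE (bigD1 j) //= big1 ?addr0 => [/eqP|i].
  by rewrite mulf_eq0 (negPf (Ud j)) orbF => /eqP.
rewrite neq_ltn => /orP[lt_ij|lt_ji]; last by rewrite U0 ?mulr0.
rewrite IH ?mul0r //; first exact: leq_trans lt_ij le_jk.
exact: ltn_trans lt_ij lt_jn.
Qed.

(** This is elimination in row [a] by the rows above it, carried as far to the right as possible. As
    [S] is invertible, it stops at a nonzero entry, the pivot in column [n]. *)
Lemma leading_position (F : fieldType) (m : nat) (S : 'M[F]_m) (a : 'I_m) :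
    S \in unitmx ->
  exists (n : 'I_m) (w : 'rV[F]_m),
    [/\ w 0 a = 1, forall c : 'I_m, (a < c)%N -> w 0 c = 0,
        forall b : 'I_m, (b < n)%N -> (w *m S) 0 b = 0,
        (w *m S) 0 n != 0
      & forall (k : nat) (w' : 'rV[F]_m), w' 0 a != 0 ->
          (forall c : 'I_m, (a < c)%N -> w' 0 c = 0) ->
          (forall b : 'I_m, (b < k)%N -> (w' *m S) 0 b = 0) -> (k <= n)%N].
Proof.
move=> Su.
(* Q k states decidably, as a row space inclusion, that some w in
   e_a + span(e_c, c < a) has k leading zeros in w S. *)
pose pm k : 'M[F]_m := pid_mx k.
pose Q k := (row a S *m pm k <= pm a *m S *m pm k)%MS.
have subrowE (u v : 'rV[F]_m) b : (u - v) 0 b = u 0 b - v 0 b by rewrite !mxE.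
have scalerowE q (v : 'rV[F]_m) b : (q *: v) 0 b = q * v 0 b by rewrite mxE.
have mulpid p (v : 'rV[F]_m) (b : 'I_m) :
    (v *m pm p) 0 b = v 0 b *+ (b < p).
  rewrite mxE (bigD1 b) //= big1 ?addr0 => [|i /negPf ib].
    by rewrite mxE eqxx; case: (b < p)%N; rewrite ?mulr1 ?mulr0.
  by rewrite mxE [_ == _]ib mulr0.
have QP k : reflect (exists w : 'rV[F]_m,
    [/\ w 0 a = 1, forall c : 'I_m, (a < c)%N -> w 0 c = 0
      & forall b : 'I_m, (b < k)%N -> (w *m S) 0 b = 0]) (Q k).
  apply: (iffP submxP) => [[D eqD]|[w [wa wc wb]]].
    exists (delta_mx 0 a - D *m pm a); split=> [|c lt_ac|b lt_bk].
    - by rewrite subrowE mulpid ltnn mxE !eqxx subr0.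
    - rewrite subrowE mulpid ltnNge (ltnW lt_ac) /= mxE subr0 eqxx /=.
      by case: eqP lt_ac => // ->; rewrite ltnn.
    rewrite mulmxBl -rowE subrowE -mulmxA.
    move/rowP/(_ b): eqD; rewrite mulpid mulmxA mulpid lt_bk !mulr1n => ->.
    by rewrite subrr.
  exists (delta_mx 0 a - w); apply/rowP=> b; rewrite !mulmxA !mulpid.
  have -> : (delta_mx 0 a - w) *m pm a = delta_mx 0 a - w.
    apply/rowP=> c; rewrite mulpid; case: (ltngtP c a) => [//|ac|/val_inj ->].
      rewrite !mxE wc // eqxx subr0 /=.
      by case: eqP ac => // ->; rewrite ltnn.
    by rewrite !mxE wa !eqxx subrr.
  rewrite mulmxBl -rowE; case: ltnP => // lt_bk.
  by rewrite subrowE wb // subr0.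
have Q0 : exists k, Q k.
  exists 0; apply/QP; exists (delta_mx 0 a).
  split=> [|c ac|//]; rewrite !mxE !eqxx //=.
  by case: eqP ac => // ->; rewrite ltnn.
have Qlt k : Q k -> (k < m)%N.
  case/QP=> w [wa _ wb]; rewrite ltnNge; apply/negP=> le_mk.
  have w0 : w *m S = 0.
    by apply/rowP=> b; rewrite wb ?mxE // (leq_trans (ltn_ord b)).
  move: wa; rewrite -[w](mulmxK Su) w0 mul0mx mxE => /eqP.
  by rewrite eq_sym oner_eq0.
have Qle k : Q k -> (k <= m)%N by move/Qlt/ltnW.
case: (ex_maxnP Q0 Qle) => k Qk kmax.
case/QP: (Qk) => w [wa wc wb]; exists (Ordinal (Qlt k Qk)), w.
split=> //= [|k' w' w'a w'c w'b].
  apply/eqP=> wk; suff: Q k.+1 by move/kmax; rewrite ltnn.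
  apply/QP; exists w; split=> // b; rewrite ltnS leq_eqVlt.
  by case/orP=> [/eqP bk|/wb //]; rewrite -wk; congr (_ _ _); apply: val_inj.
apply: kmax; apply/QP; exists ((w' 0 a)^-1 *: w'); split=> [|c ac|b bk].
- by rewrite mxE mulVf.
- by rewrite scalerowE (w'c c) // mulr0.
by rewrite -scalemxAl scalerowE w'b // mulr0.
Qed.

(** The values of [s] and of its inverse have the same sum, so the pointwise inequality is an
    equality. *)
Lemma perm_leq_inv_id (m : nat) (s : {perm 'I_m}) :
  (forall a, s^-1%g a <= s a)%N -> (s ^+ 2 = 1)%g.
Proof.
move=> le_s.
have eq_sum : (\sum_a s^-1%g a = \sum_a s a :> nat)%N.
  rewrite (reindex_inj (@perm_inj _ s)) /=.
  rewrite [RHS](reindex_inj (@perm_inj _ (s^-1)%g)) /=.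
  by apply: eq_bigr => a _; rewrite permK permKV.
have eq_s a : s^-1%g a = s a.
  apply/val_inj/eqP; rewrite eqn_leq le_s /= leqNgt; apply/negP=> lt_a.
  suff: (\sum_a s^-1%g a < \sum_a s a)%N by rewrite eq_sum ltnn.
  rewrite (bigD1 a) //= [X in (_ < X)%N](bigD1 a) //= -addSn leq_add //.
  by apply: leq_sum => b _.
by apply/permP=> a; rewrite expgS expg1 permM perm1 -eq_s permK.
Qed.

(* s a is characterised as the largest number of leading zeros of w S for w in
   e_a + span(e_c, c < a); row b of U^T, up to a scalar, is such a w for b, with
   s^-1 b leading zeros. So s^-1 b <= s b for all b, and s is an involution. *)
Lemma symmetric_bruhat (F : fieldType) (m : nat) (S : 'M[F]_m) :
    S \in unitmx -> S^T = S ->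
  exists (s : {perm 'I_m}) (L U : 'M[F]_m),
    [/\ forall a c : 'I_m, (a < c)%N -> L a c = 0, forall a, L a a = 1,
        forall b d : 'I_m, (b < d)%N -> U d b = 0,
        L *m S *m U = perm_mx s & (s ^+ 2 = 1)%g] /\
    (forall a b : 'I_m, (b < s a)%N -> (L *m S) a b = 0) /\
    (forall (a : 'I_m) (k : nat) (w : 'rV[F]_m), w 0 a != 0 ->
       (forall c : 'I_m, (a < c)%N -> w 0 c = 0) ->
       (forall b : 'I_m, (b < k)%N -> (w *m S) 0 b = 0) -> (k <= s a)%N).
Proof.
move=> Su St.
have /fin_all_exists[f /fin_all_exists[W fW]] :=
  fun a => leading_position a Su.
pose L : 'M_m := \matrix_(a, c) W a 0 c.
have rowL a : row a L = W a by apply/rowP=> c; rewrite !mxE.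
have LSE a b : (L *m S) a b = (W a *m S) 0 b by rewrite -rowL -row_mul [RHS]mxE.
have Wa (a : 'I_m) : W a 0 a = 1 by have [] := fW a.
have Wc (a c : 'I_m) : (a < c)%N -> W a 0 c = 0.
  by case: (fW a) => _ H _ _ _; apply: H.
have Wb (a b : 'I_m) : (b < f a)%N -> (W a *m S) 0 b = 0.
  by case: (fW a) => _ _ H _ _; apply: H.
have Wf (a : 'I_m) : (W a *m S) 0 (f a) != 0 by have [] := fW a.
have fmax (a : 'I_m) : forall (k : nat) (w' : 'rV[F]_m), w' 0 a != 0 ->
          (forall c : 'I_m, (a < c)%N -> w' 0 c = 0) ->
          (forall b : 'I_m, (b < k)%N -> (w' *m S) 0 b = 0) -> (k <= f a)%N.
  by have [] := fW a.
have subrowE (u v : 'rV[F]_m) b : (u - v) 0 b = u 0 b - v 0 b by rewrite !mxE.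
have scalerowE q (v : 'rV[F]_m) b : (q *: v) 0 b = q * v 0 b by rewrite mxE.
have f_neq (a a' : 'I_m) : (a < a')%N -> f a != f a'.
  move=> lt_a; apply/eqP=> fa.
  (* If the pivot columns agreed, subtracting [q] times [W a] from [W a'] would clear the pivot of
     the latter and contradict the maximality of [f a']. *)
  pose q := (W a' *m S) 0 (f a) / (W a *m S) 0 (f a).
  suff: ((f a).+1 <= f a')%N by rewrite fa ltnn.
  apply: (fmax a' _ (W a' - q *: W a)) => [|c lt_c|b].
  - by rewrite !mxE Wa (Wc a) // mulr0 subr0 oner_eq0.
  - by rewrite !mxE !Wc ?mulr0 ?subr0 // (ltn_trans lt_a).
  rewrite ltnS mulmxBl -scalemxAl subrowE scalerowE.
  rewrite leq_eqVlt => /orP[/eqP/val_inj->|lt_b].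
    by rewrite divfK ?subrr.
  by rewrite !Wb ?mulr0 ?subr0 // -fa.
have f_inj : injective f.
  move=> a a' fa; apply/val_inj; case: (ltngtP a a') => // /f_neq.
    by rewrite fa eqxx.
  by rewrite fa eqxx.
pose s := perm f_inj.
have sE a : s a = f a by rewrite permE.
(* Sorting the rows of [L *m S] by pivot column gives an upper triangular matrix with nonzero
   diagonal; its inverse will be [U]. *)
pose V := perm_mx (s^-1)%g *m (L *m S).
have VE a b : V (s a) b = (W a *m S) 0 b.
  by rewrite /V -row_permE mxE permK LSE.
have V0 (i j : 'I_m) : (j < i)%N -> V i j = 0.
  by rewrite -(permKV s i) VE sE; apply: Wb.
have Vd i : V i i != 0.
  by rewrite -(permKV s i) VE sE.
have Vu : V \in unitmx.
  rewrite unitmxE -det_tr det_trig ?unitfE.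
    by apply/prodf_neq0=> i _; rewrite mxE.
  by apply/is_trig_mxP=> i j ij; rewrite mxE V0.
have LSV : L *m S = perm_mx s *m V.
  by rewrite /V mulmxA -perm_mxM mulgV perm_mx1 mul1mx.
pose U := invmx V.
have LSU : L *m S *m U = perm_mx s by rewrite LSV mulmxK.
have U0 (b d : 'I_m) : (b < d)%N -> U d b = 0.
  move=> lt_bd; have -> : U d b = (row d U) 0 b by rewrite mxE.
  apply: (upper_solve (U := V) (n := d)) => // j lt_jd.
  rewrite -row_mul mulVmx // !mxE.
  by case: eqP lt_jd => // ->; rewrite ltnn.
have Ud b : U b b != 0.
  apply/eqP=> Ub; have := mulVmx Vu => /matrixP/(_ b b).
  rewrite !mxE eqxx big1 => [/eqP|j _]; first by rewrite eq_sym oner_eq0.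
  have [lt_jb|lt_bj|/val_inj->] := ltngtP j b; last by rewrite Ub mul0r.
    by rewrite U0 ?mul0r.
  by rewrite V0 ?mulr0.
exists s, L, U; split; last split=> [a b|a k w wa wc wb].
- split=> // [a c ac|a|]; [by rewrite mxE Wc|by rewrite mxE|].
  apply: perm_leq_inv_id => b; rewrite sE.
  apply: (fmax b _ (row b U^T)) => [|c bc|c lt_c]; first by rewrite !mxE.
    by rewrite !mxE U0.
  (* As [S] is symmetric, transposing [LSU] gives [U^T *m S *m L^T = (perm_mx s)^T], whose row [b]
     has its 1 in column [s^-1 b]. Undoing the triangular factor [L^T] keeps the zeros before that
     column. *)
  apply: (upper_solve (U := L^T) (n := s^-1%g b)) lt_c => [i j ji|i|j lt_j].
  + by rewrite !mxE Wc.
  + by rewrite !mxE Wa oner_eq0.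
  have -> : row b U^T *m S *m L^T = row b (perm_mx s)^T.
    by rewrite -LSU !trmx_mul St !row_mul mulmxA.
  rewrite !mxE; case: eqP lt_j => // <-.
  by rewrite permK ltnn.
- by rewrite sE LSE; apply: Wb.
- by rewrite sE; apply: (fmax a _ w).
Qed.

(** * Partitions recovered from truncated sums *)

(** The indices [j] with [k < f j] form an initial segment. *)
Lemma nonincreasing_gt_card (m : nat) (f : 'I_m -> nat) :
    (forall i j : 'I_m, (i <= j)%N -> (f j <= f i)%N) ->
  forall (i : 'I_m) (k : nat), (k < f i)%N = (i < #|[pred j | (k < f j)%N]|)%N.
Proof.
move=> f_le i k.
have card_lt c (le_cm : (c <= m)%N) : #|[pred j : 'I_m | (j < c)%N]| = c.
  rewrite -sum1_card -(big_ord_widen m (fun=> 1%N)) //.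
  by rewrite sum_nat_const card_ord muln1.
apply/idP/idP => [lt_k|].
  rewrite -[X in (X <= _)%N](card_lt i.+1) //.
  apply/subset_leq_card/subsetP=> j.
  by rewrite !inE ltnS => /f_le; apply: leq_trans.
apply: contraTT; rewrite -!leqNgt => le_k.
rewrite -[X in (_ <= X)%N](card_lt i (ltnW (ltn_ord i))).
apply/subset_leq_card/subsetP=> j; rewrite !inE; apply: contraTT.
by rewrite -!leqNgt => /f_le /leq_trans; apply.
Qed.

(** Successive sums differ by the number of values exceeding [k], that is, by a part of the
    conjugate partition. *)
Lemma nonincreasing_eq (m : nat) (f g : 'I_m -> nat) :
    (forall i j : 'I_m, (i <= j)%N -> (f j <= f i)%N) ->
    (forall i j : 'I_m, (i <= j)%N -> (g j <= g i)%N) ->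
    (forall k, \sum_i (f i - k) = \sum_i (g i - k))%N ->
  f =1 g.
Proof.
move=> f_le g_le fg.
have step (h : 'I_m -> nat) k :
    (\sum_i (h i - k) = #|[pred j | k < h j]| + \sum_i (h i - k.+1))%N.
  rewrite -sum1_card [X in _ = (X + _)%N]big_mkcond -big_split.
  apply: eq_bigr => i _ /=.
  by rewrite inE; case: ltnP => /= ?; lia.
have eq_lt i k : (k < f i)%N = (k < g i)%N.
  rewrite !nonincreasing_gt_card //; congr (_ < _)%N.
  by apply/eqP; rewrite -(eqn_add2r (\sum_i (f i - k.+1))) -step fg step -fg.
move=> i; have := eq_lt i (g i); have := eq_lt i (f i); rewrite !ltnn.
by case: ltngtP.
Qed.

(** * Jordan type and ranks of powers *)

Lemma shift_mxXE (F : fieldType) (l k : nat) (i j : 'I_l) :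
  (shift_mx F l ^+ k) i j = (j == (i + k)%N :> nat)%:R.
Proof.
elim: k j => [|k IH] j.
  by rewrite expr0 mxE addn0 eq_sym.
rewrite exprSr -mulmxE mxE; under eq_bigr => a _ do rewrite IH mxE.
have [lt_l|le_l] := ltnP (i + k)%N l.
  rewrite (bigD1 (Ordinal lt_l)) //= eqxx mul1r big1 ?addr0 ?addnS // => a.
  by rewrite -val_eqE /= => /negPf->; rewrite mul0r.
rewrite big1 => [|a _]; last first.
  by case: eqP (ltn_ord a) => [->|_ _]; rewrite ?mul0r // ltnNge le_l.
by case: eqP => // ej; have := ltn_ord j; lia.
Qed.

Lemma rank_shift_mxX (F : fieldType) (l k : nat) :
  \rank (shift_mx F l ^+ k) = (l - k)%N.
Proof.
(* The default [i] of [insubd] is taken only for rows outside the domain, which vanish. *)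
rewrite (@rank_partial_perm_mx _ _ _ _ [pred i : 'I_l | (i + k < l)%N]
           (fun i => insubd i (i + k)%N)).
- rewrite -sum1_card -[RHS]card_ord -[#|'I_(l - k)|]sum1_card.
  rewrite (big_ord_widen l (fun=> 1%N)) ?leq_subr //.
  by apply: eq_bigl => i; rewrite inE; lia.
- move=> i j; rewrite shift_mxXE inE -val_eqE val_insubd.
  case: ltnP => //= le_l; case: eqP => // ej.
  by have := ltn_ord j; rewrite ej ltnNge le_l.
move=> i j; rewrite !inE => li lj /(congr1 val); rewrite !val_insubd li lj.
by move/addIn/val_inj.
Qed.

Lemma mxdiagX (F : fieldType) (m : nat) (d : 'I_m -> nat)
    (B : forall i, 'M[F]_(d i)) (k : nat) :
  (\mxdiag_(i < m) B i) ^+ k = \mxdiag_(i < m) (B i ^+ k).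
Proof.
elim: k => [|k IH]; first by rewrite expr0 -idmxE -mxdiagZ.
rewrite exprS IH -mulmxE /mxdiag mul_mxdiag_mxblock.
apply/eq_mxblockP => i j; case: eqP => [ij|_]; last by rewrite mulmx0.
by case: _ / ij; rewrite !conform_mx_id exprS.
Qed.

(** Similarity carries [A - 1%:M] to a block diagonal of nilpotent shifts, whose powers have known
    rank. *)
Lemma rank_sub1X (F : fieldType) (n m : nat) (A : 'M[F]_n)
    (lam : m.-tuple nat) (k : nat) :
    unipotent_jordan_type A lam ->
  \rank ((A - 1%:M) ^+ k) = (\sum_(i < m) (tnth lam i - k))%N.
Proof.
case=> _ _ [e]; case: _ / e A => A.
rewrite castmx_id => -[P Pu /(mxpoly.simmxLR Pu) A_conj].
have AE : A = invmx P *m (\mxdiag_(i < m) jordan_block F (tnth lam i)) *m P.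
  by rewrite A_conj mxpoly.conjVmx.
have -> : A - 1%:M = invmx P *m (\mxdiag_(i < m) shift_mx F (tnth lam i)) *m P.
  rewrite AE /jordan_block mxdiagD mulmxDr mulmxDl mxdiagZ mulmx1 mulVmx //.
  by rewrite addrC addKr.
have XE (B : 'M[F]_(\sum_(i < m) tnth lam i)) :
    (invmx P *m B *m P) ^+ k = invmx P *m B ^+ k *m P.
  elim: k => [|k IH]; first by rewrite !expr0 mulmx1 mulVmx.
  by rewrite !exprS IH -!mulmxE !mulmxA mulmxK // !mulmxA.
rewrite XE mxrankMfree ?row_free_unit //.
rewrite eqmxMfull ?row_full_unit ?unitmx_inv //.
by rewrite mxdiagX rank_mxdiag; apply: eq_bigr => i _; rewrite rank_shift_mxX.
Qed.

(** For [m = r] and [N = r + s - 2] the total is [r * s]: the expected block sizes fill the space.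
    The bound on [m] keeps the differences untruncated. *)
Lemma sum_add_perm (m N : nat) (s : {perm 'I_m}) : (m.*2 <= N.+2)%N ->
  (\sum_(a < m) (N.+1 - (a + s a)) = m * (N.+2 - m))%N.
Proof.
move=> le_m; rewrite sumnB => [|a _]; last first.
  by have := ltn_ord a; have := ltn_ord (s a); lia.
have sum_s : (\sum_(a < m) s a = \sum_(a < m) a)%N.
  by rewrite [RHS](reindex_inj (@perm_inj _ s)).
rewrite big_split /= sum_s.
rewrite sum_nat_const card_ord addnn.
have := bin2_sum m; rewrite big_mkord => ->.
have := mul_bin_diag m 1; rewrite bin1.
case: m s le_m {sum_s} => [|m] _ le_m; nia.
Qed.

(** * Ranks of the powers of [t] from an abstract graded pairing *)

Section GradedPairing.

Variables (F : fieldType) (n : nat) (e : 'rV[F]_n) (c : 'cV[F]_n).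

(** The bilinear pairing of two commuting operators is this functional evaluated at their
    product. *)
Definition pairing (g : 'M[F]_n) : F := (e *m g *m c) 0 0.

Lemma pairing_sum (I : finType) (P : pred I) (f : I -> 'M[F]_n) :
  pairing (\sum_(i | P i) f i) = \sum_(i | P i) pairing (f i).
Proof. by rewrite /pairing mulmx_sumr mulmx_suml summxE. Qed.

Lemma pairingZ (a : F) (g : 'M[F]_n) : pairing (a *: g) = a * pairing g.
Proof. by rewrite /pairing -scalemxAr -scalemxAl mxE. Qed.

Variables (r s : nat) (x t : 'M[F]_n).
Let N := (r + s - 2)%N.
Hypothesis n_eq : n = (r * s)%N.
Hypotheses (r_gt0 : (0 < r)%N) (le_rs : (r <= s)%N).
Hypothesis comm_xt : GRing.comm x t.
Hypothesis pairing_deg : forall a m : nat, (a + m)%N != N ->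
  pairing (x ^+ a * t ^+ m) = 0.

(** Since [r <= s], the degree [a + b] is at most [N], so the exponent of [t] is not truncated. *)
Definition pairing_mx : 'M[F]_r :=
  \matrix_(a, b) pairing (x ^+ (a + b) * t ^+ (N - (a + b))).

Variables (L U : 'M[F]_r) (sigma : {perm 'I_r}).
Hypothesis L_lower : forall a d : 'I_r, (a < d)%N -> L a d = 0.
Hypothesis U_upper : forall b d : 'I_r, (b < d)%N -> U d b = 0.
Hypothesis LSU : L *m pairing_mx *m U = perm_mx sigma.

(* As L and U are triangular, the truncated exponents are those of homogeneous
   elements of degrees a and b. *)
Let u (a : 'I_r) := \sum_d L a d *: (x ^+ d * t ^+ (a - d)).
Let v (b : 'I_r) := \sum_d U d b *: (x ^+ d * t ^+ (b - d)).

(** The product is homogeneous of degree [a + b + m], hence pairs to 0 unless this is [N]; in degree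
    [N] its value is the entry [(a, b)] of [L *m pairing_mx *m U]. *)
Let pairing_uv (a b : 'I_r) (m : nat) :
  pairing (u a * t ^+ m * v b) = ((sigma a == b) && (a + b + m == N)%N)%:R.
Proof.
have comm_tx i j : t ^+ i * x ^+ j = x ^+ j * t ^+ i.
  exact/commrX/commr_sym/commrX.
have -> : pairing (u a * t ^+ m * v b) =
    \sum_d2 \sum_d1 (a + b + m == N)%N%:R *
      (L a d1 * pairing_mx d1 d2 * U d2 b).
  rewrite mulr_sumr pairing_sum; apply: eq_bigr => d2 _.
  rewrite -mulrA mulr_suml pairing_sum; apply: eq_bigr => d1 _.
  rewrite -!mulmxE -scalemxAl pairingZ -!scalemxAr pairingZ !mulmxE.
  have [a_d1|d1_a] := ltnP a d1; first by rewrite L_lower // !mul0r mulr0.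
  have [b_d2|d2_b] := ltnP b d2; first by rewrite U_upper // mul0r !mulr0.
  have -> : x ^+ d1 * t ^+ (a - d1) * (t ^+ m * (x ^+ d2 * t ^+ (b - d2))) =
            x ^+ (d1 + d2) * t ^+ (a - d1 + m + (b - d2)).
    rewrite !exprD -!mulrA; congr (_ * _).
    rewrite (mulrA (t ^+ m)) comm_tx -(mulrA (x ^+ d2)).
    by rewrite (mulrA (t ^+ (a - d1))) comm_tx -mulrA.
  case: eqP => [N_eq|/eqP N_neq].
    rewrite mxE (_ : (N - (d1 + d2) = a - d1 + m + (b - d2))%N); last by lia.
    by rewrite mul1r -mulrA; congr (_ * _); rewrite mulrC.
  by rewrite pairing_deg ?mulr0 ?mul0r //; apply: contra N_neq; lia.
under eq_bigr => d _ do rewrite -mulr_sumr -mulr_suml.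
rewrite -mulr_sumr mulrC -mulnb natrM; congr (_ * _).
transitivity ((L *m pairing_mx *m U) a b); last by rewrite LSU !mxE.
by rewrite mxE; apply: eq_bigr => d _; rewrite [(L *m _) a d]mxE.
Qed.

Let index := mxtens_unindex (m := r) (n := N.+1).
(** The exponent of [t] runs up to [N] for every generator, so there may be more rows than the
    dimension; only ranks are taken. *)
Let B : 'M[F]_(r * N.+1, n) :=
  \matrix_p (e *m (u (index p).1 *m t ^+ (index p).2)).
Let C : 'M[F]_(n, r * N.+1) :=
  \matrix_(i, q) ((t ^+ (index q).2 *m v (index q).1) *m c) i 0.

(** By [pairing_uv] this is a partial permutation matrix: row [(a, i)] has its only 1 in column
    [(sigma a, j)] with [j = N - (a + sigma a + i + k)], provided that this difference is not
    negative. The rank counts the admissible [i]. *)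
Let rank_gram (k : nat) :
  \rank (B *m t ^+ k *m C) = (\sum_(a < r) (N.+1 - (a + sigma a) - k))%N.
Proof.
have gramE p q : (B *m t ^+ k *m C) p q =
    ((sigma (index p).1 == (index q).1) &&
    ((index p).1 + (index q).1 + ((index p).2 + k + (index q).2) == N)%N)%:R.
  rewrite -pairing_uv /pairing.
  have -> : (B *m t ^+ k *m C) p q = (row p B *m t ^+ k *m col q C) 0 0.
    by rewrite -!row_mul !mxE; apply: eq_bigr => i _; rewrite !mxE.
  have -> : row p B = e *m (u (index p).1 *m t ^+ (index p).2).
    by apply/rowP=> i; rewrite !mxE.
  have -> : col q C = (t ^+ (index q).2 *m v (index q).1) *m c.
    by apply/colP=> i; rewrite !mxE.
  by rewrite !exprD !mulmxE !mulrA !mulmxA.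
rewrite (@rank_partial_perm_mx _ _ _ _
  [pred p | (index p).1 + sigma (index p).1 + (index p).2 + k <= N]%N
  (fun p => mxtens_index (sigma (index p).1,
     inord (N - ((index p).1 + sigma (index p).1 + (index p).2 + k))%N))).
- rewrite -sum1_card; transitivity
    (\sum_(a < r) \sum_(i < N.+1 | (a + sigma a + i + k <= N)%N) 1)%N.
    rewrite pair_big_dep (reindex index) //; apply: onW_bij.
    exists (@mxtens_index r N.+1); first exact: mxtens_unindexK.
    exact: mxtens_indexK.
  apply: eq_bigr => a _.
  rewrite -[RHS]card_ord -[#|'I_(_)|]sum1_card.
  rewrite (big_ord_widen N.+1 (fun=> 1%N)); last by lia.
  by apply: eq_bigl => i; lia.
- move=> p q; rewrite gramE; congr (_ : bool)%:R.
  rewrite inE -(can_eq (@mxtens_unindexK r N.+1)) mxtens_indexK -/(index q).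
  case: (index q) => b j; rewrite xpair_eqE [b == _]eq_sym.
  case: (index p) => a i /=; have lt_j := ltn_ord j.
  rewrite andbCA; case: eqVneq => //= ->.
  case: (leqP _ N) => /= le_N; last by lia.
  by rewrite -val_eqE /= inordK; lia.
move=> p q; rewrite !inE => Dp Dq eq_pq.
apply: (can_inj (@mxtens_unindexK r N.+1)).
move: eq_pq Dp Dq; rewrite -!/(index _).
case: (index p) (index q) => [a i] [b j] /= /(can_inj (@mxtens_indexK _ _)).
move=> [/perm_inj-> /(congr1 val)] + Dp Dq; rewrite /= !inordK; [|lia|lia].
by move=> eq_ij; congr (_, _); apply/val_inj => /=; lia.
Qed.

(* For k = 0 the rank of B C is the full dimension r s, which shows at once that
   the families u_a t^i and t^j v_b both span. *)
Lemma rank_gradedX (k : nat) :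
  \rank (t ^+ k) = (\sum_(a < r) (N.+1 - (a + sigma a) - k))%N.
Proof.
have rankBC : \rank (B *m C) = n.
  have -> : B *m C = B *m t ^+ 0 *m C by rewrite expr0 mulmx1.
  rewrite rank_gram; under eq_bigr do rewrite subn0.
  have le_N : (r.*2 <= N.+2)%N by rewrite /N; lia.
  by rewrite sum_add_perm // [RHS]n_eq; congr (_ * _)%N; rewrite /N; lia.
have B_full : row_full B.
  by rewrite /row_full eqn_leq rank_leq_col -{1}rankBC mxrankM_maxl.
have C_free : row_free C.
  by rewrite /row_free eqn_leq rank_leq_row -{1}rankBC mxrankM_maxr.
by rewrite -rank_gram mxrankMfree // eqmxMfull.
Qed.

End GradedPairing.

(** * The concrete pairing on the tensor product *)

Section TensorPairing.

Variables (F : fieldType) (r s : nat).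
Hypotheses (r_gt0 : (0 < r)%N) (s_gt0 : (0 < s)%N).
Let N := (r + s - 2)%N.
Let x : 'M[F]_(r * s) := shift_mx F r *t 1%:M.
(** The left factor is [jordan_block F r] rather than [1%:M], which absorbs the mixed term of the
    product and makes [t = x + y] exact. *)
Let y : 'M[F]_(r * s) := jordan_block F r *t shift_mx F s.
Let t : 'M[F]_(r * s) := jordan_block F r *t jordan_block F s - 1%:M.

Let tens11 : (1%:M : 'M[F]_r) *t (1%:M : 'M[F]_s) = 1%:M.
Proof.
apply/matrixP=> p q; rewrite !mxE -(can_eq (@mxtens_unindexK r s)) -natrM mulnb.
by rewrite -xpair_eqE -!surjective_pairing.
Qed.

Let tensX (A : 'M[F]_r) (B : 'M[F]_s) k : (A *t B) ^+ k = A ^+ k *t B ^+ k.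
Proof.
elim: k => [|k IH]; first by rewrite !expr0 -!idmxE tens11.
by rewrite !exprS IH -!mulmxE tensmx_mul.
Qed.

Let comm_shift_jordan : GRing.comm (shift_mx F r) (jordan_block F r).
Proof. by apply: commrD; [apply: commr1|]. Qed.

Let comm_xy : GRing.comm x y.
Proof.
rewrite /GRing.comm /x /y -!mulmxE !tensmx_mul mulmx1 mul1mx !mulmxE.
by rewrite comm_shift_jordan.
Qed.

Let tE : t = x + y.
Proof.
rewrite /t /x /y -tens11; apply/matrixP=> p q; rewrite !mxE.
by rewrite mulrDr mulrDl mulrDl; ring.
Qed.

Lemma comm_shift_tens : GRing.comm x t.
Proof. by rewrite tE; apply: commrD. Qed.

Lemma jordan_blockX_unit k : jordan_block F r ^+ k \in unitmx.
Proof.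
elim: k => [|k IH]; first exact: unitmx1.
rewrite exprS -mulmxE unitmx_mul IH andbT unitmxE -det_tr det_trig.
  rewrite big1 ?unitr1 // => i _; rewrite !mxE eqxx.
  by rewrite eqn_leq ltnn andbF addr0.
apply/is_trig_mxP=> i j lt_ij; rewrite !mxE -val_eqE /= gtn_eqF // add0r.
by case: eqP => // ij; move: lt_ij; rewrite ij; lia.
Qed.

Let i0 : 'I_r := Ordinal r_gt0.
Let j0 : 'I_s := Ordinal s_gt0.

(* The factor J_r^-(s-1) compensates for the factor J_r^(s-1) in y^(s-1): the
   pairing of these two vectors is the coefficient of x^(r-1) y^(s-1). *)
Definition tens_row : 'rV[F]_(r * s) := delta_mx 0 (mxtens_index (i0, j0)).

Definition tens_col : 'cV[F]_(r * s) :=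
  (invmx (jordan_block F r ^+ s.-1) *t 1%:M) *m
  delta_mx (mxtens_index (rev_ord i0, rev_ord j0)) 0.

(** In the binomial expansion of [(x + y) ^+ m] only the term in [y ^+ s.-1] can contribute, and it
    does when the total power of [x] is [r.-1]. *)
Lemma pairing_shift_tens (a m : nat) :
  pairing tens_row tens_col (x ^+ a * t ^+ m) =
    'C(m, s.-1)%:R * (a + m == N)%N%:R.
Proof.
have xyE i j : pairing tens_row tens_col (x ^+ i * y ^+ j) =
    ((i == r.-1) && (j == s.-1))%:R.
  have entryE (M : 'M[F]_(r * s)) p q :
      (delta_mx 0 p *m M *m delta_mx q 0 : 'M_1) 0 0 = M p q.
    by rewrite -rowE -colE !mxE.
  rewrite /pairing /tens_row /tens_col mulmxA -[X in X *m _]mulmxA entryE.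
  rewrite /x /y !tensX -!mulmxE !tensmx_mul tensmxE idmxE expr1n mul1mx mulmx1.
  rewrite shift_mxXE /= subn1 add0n [s.-1 == j]eq_sym -mulnb natrM.
  case: eqP => [->|_]; last by rewrite !mulr0.
  rewrite mulmxK ?jordan_blockX_unit // shift_mxXE /= subn1 add0n.
  by rewrite [r.-1 == i]eq_sym.
rewrite tE exprDn_comm // mulr_sumr pairing_sum.
under eq_bigr => i _ do rewrite mulrnAr -scaler_nat pairingZ mulrA -exprD xyE.
have [le_sm|lt_ms] := leqP s.-1 m; last first.
  rewrite bin_small // mul0r big1 // => i _.
  case: (i =P s.-1 :> nat) => [i_s|_]; last by rewrite andbF mulr0.
  by have := ltn_ord i; lia.
rewrite (bigD1 (inord s.-1)) //= inordK // eqxx andbT big1 ?addr0 => [|i].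
  by congr (_ * (_ : bool)%:R); rewrite /N; lia.
rewrite -val_eqE /= inordK // => /negPf->.
by rewrite andbF mulr0.
Qed.

End TensorPairing.

(** * Hankel matrices and the Norman permutation *)

(** Both sides have entries [h (a + b).+1]; where the shift leaves the matrix, this value is 0 by
    the vanishing of [h]. *)
Lemma hankel_shift_sym (F : fieldType) (m : nat) (h : nat -> F) :
    (forall k, (m <= k)%N -> h k = 0) ->
  let S := \matrix_(a < m, b < m) h (a + b)%N in
  shift_mx F m *m S = S *m (shift_mx F m)^T.
Proof.
move=> h0 S; have shiftS a b : (shift_mx F m *m S) a b = h (a + b).+1.
  rewrite mxE; have [lt_a|le_m] := ltnP a.+1 m.
    rewrite (bigD1 (Ordinal lt_a)) //= !mxE eqxx mul1r big1 ?addr0 // => d.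
    by rewrite -val_eqE mxE => /negPf /= ->; rewrite mul0r.
  rewrite h0 ?big1 // => [d _|]; last by lia.
  rewrite mxE; case: eqP => [d_a|]; rewrite ?mul0r //.
  by have := ltn_ord d; lia.
have St : S^T = S by apply/matrixP=> a b; rewrite !mxE addnC.
by apply/matrixP=> a b; rewrite shiftS -{1}St -trmx_mul mxE shiftS addnC.
Qed.

(** Reversing the rows gives a lower triangular matrix with constant diagonal [h m.-1]. *)
Lemma antitriangular_hankel_unit (F : fieldType) (m : nat) (h : nat -> F) :
    (forall k, (m <= k)%N -> h k = 0) -> h m.-1 != 0 ->
  (\matrix_(a < m, b < m) h (a + b)%N) \in unitmx.
Proof.
move=> h0 hm; set S := \matrix_(_, _) _.
pose p : {perm 'I_m} := perm (@rev_ord_inj m).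
suff: row_perm p S \in unitmx by rewrite row_permE unitmx_mul unitmx_perm.
rewrite unitmxE det_trig ?unitfE; last first.
  apply/is_trig_mxP=> i j lt_ij; rewrite !mxE permE /= h0 //.
  by have := ltn_ord i; lia.
apply/prodf_neq0=> i _; rewrite !mxE permE /= (_ : (m - i.+1 + i = m.-1)%N) //.
by have := ltn_ord i; lia.
Qed.

Theorem corollary4p2 (r s p : nat) (hr : (1 <= r)%N) (hrs : (r <= s)%N)
    (hp : prime p) (F : fieldType) (hF : p \in [pchar F])
    (lam : r.-tuple nat)
    (hlam : unipotent_jordan_type (jordan_block F r *t jordan_block F s) lam) :
  exists2 pi : {perm 'I_r}, is_norman_perm s lam pi & (pi ^+ 2 = 1)%g.
Proof.
have s_gt0 : (0 < s)%N by apply: leq_trans hrs.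
(* The factor [(k < r)] makes [h] vanish from [r] on even for [s = 1], where the truncated [N - k]
   would give ['C(0, 0) = 1]. On the entries of [S] it does not change the binomial. *)
pose N := (r + s - 2)%N; pose h k : F := 'C(N - k, s.-1)%:R *+ (k < r).
pose S : 'M[F]_r := \matrix_(a, b) h (a + b)%N.
have h0 k : (r <= k)%N -> h k = 0 by rewrite /h ltnNge => ->.
have S_unit : S \in unitmx.
  apply: antitriangular_hankel_unit => //; rewrite /h prednK // leqnn.
  (* The antidiagonal entry is 1 in every characteristic. *)
  by rewrite (_ : (N - r.-1 = s.-1)%N) ?binn ?oner_eq0 // /N; lia.
have S_sym : S^T = S by apply/matrixP=> a b; rewrite !mxE addnC.
have [pi [L [U [[L0 L1 U0 LSU pi2] [LS0 pi_max]]]]] :=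
  symmetric_bruhat S_unit S_sym.
(* Shifting row [a] of [L] moves its last nonzero coordinate to [a.+1]. By the Hankel property its
   product with [S] is row [a] of [L *m S] shifted left, which loses one leading zero; maximality of
   [pi b] then applies. *)
have pi_step (a b : 'I_r) : b = a.+1 :> nat -> (pi a <= (pi b).+1)%N.
  move=> b_a; pose w := row a L *m shift_mx F r.
  have wE c : w 0 c = \sum_(d < r) L a d * (c == d.+1 :> nat)%:R.
    by rewrite mxE; apply: eq_bigr => d _; rewrite !mxE.
  suff: ((pi a).-1 <= pi b)%N by lia.
  apply: (pi_max b _ w) => [|c lt_bc|c lt_c].
  - rewrite wE (bigD1 a) //= b_a eqxx mulr1 L1 big1 ?addr0 ?oner_eq0 // => d.
    by rewrite -val_eqE eqSS eq_sym => /negPf->; rewrite mulr0.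
  - rewrite wE big1 // => d _; case: eqP => [c_d|]; last by rewrite mulr0.
    by rewrite L0 ?mul0r //; lia.
  rewrite -mulmxA (hankel_shift_sym h0) -/S mulmxA -row_mul mxE big1 // => d _.
  have -> : row a (L *m S) 0 d = (L *m S) a d by rewrite mxE.
  rewrite [_^T d c]mxE [shift_mx F r c d]mxE.
  case: eqP => [d_c|_]; last by rewrite mulr0.
  by rewrite LS0 ?mul0r //; lia.
pose l (a : 'I_r) := (N.+1 - (a + pi a))%N.
(* By [pi_step], the sum [a + pi a] does not decrease when [a] grows by 1. *)
have l_anti (i j : 'I_r) : (i <= j)%N -> (l j <= l i)%N.
  have [k] := ubnP (j - i)%N; elim: k i j => // k IH i j; rewrite ltnS => le_k.
  rewrite leq_eqVlt => /predU1P[/val_inj-> //|lt_ij].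
  have lt_i : (i.+1 < r)%N by apply: leq_ltn_trans lt_ij (ltn_ord j).
  apply: (@leq_trans (l (Ordinal lt_i))); first by apply: IH => /=; lia.
  by have := pi_step i (Ordinal lt_i) erefl; rewrite /l /=; lia.
have lam_anti (i j : 'I_r) : (i <= j)%N -> (tnth lam j <= tnth lam i)%N.
  case: hlam => lam_sorted _ _ le_ij; rewrite !(tnth_nth 0).
  have geq_trans : transitive geq by move=> a b c ba cb; apply: leq_trans cb ba.
  apply: (sorted_leq_nth geq_trans (leqnn : reflexive geq)) => //;
    by rewrite inE size_tuple.
(* Both sums are the rank of the power [k] of [t], from the Jordan form and from the pairing. *)
have rank_l k : (\sum_a (tnth lam a - k) = \sum_a (l a - k))%N.
  rewrite -(rank_sub1X k hlam).
  apply: (@rank_gradedX _ _ (tens_row F hr s_gt0) (tens_col F hr s_gt0) r s _ _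
           erefl hr hrs (@comm_shift_tens F r s) _ L U) => //.
  - move=> a m /negPf aN; by rewrite pairing_shift_tens aN mulr0.
  rewrite (_ : pairing_mx _ _ _ _ _ _ = S) //.
  apply/matrixP=> a b; rewrite !mxE.
  have lt_a := ltn_ord a; have lt_b := ltn_ord b.
  rewrite pairing_shift_tens subnKC ?eqxx ?mulr1; last by lia.
  rewrite /h; case: ltnP => // le_r.
  by rewrite bin_small //; lia.
(* As [n + pi n <= N], nothing is truncated in [l], and [(r - n) + s - l n] is [pi n + 1]. *)
exists pi => // n; rewrite (nonincreasing_eq lam_anti l_anti rank_l n) /l /N.
by have := ltn_ord n; have := ltn_ord (pi n); lia.
Qed.
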